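(* For every type $X$, $\mathsf{E\text{-}HA}^\omega+\mathsf{sSpec}_{X\times\mathbb{B}}\vdash\mathsf{Spec}_X$, where $$\mathsf{Spec}_X:\ \forall\varphi^{X^{\mathbb{N}}\to\mathbb{N}}\forall\alpha^{X^{\mathbb{N}}}\exists n\,\big(\varphi(\widehat{\overline{\alpha}n})<n\big),$$ $$\mathsf{sSpec}_Z:\ \forall\varphi^{Z^{\mathbb{N}}\to\mathbb{N}}\forall\alpha^{Z^{\mathbb{N}}}\exists n\,\big(\hat\varphi([\alpha]^{\varphi}_{n})\in\mathrm{dom}([\alpha]^{\varphi}_{n})\big).$$
   Context: $\mathsf{E\text{-}HA}^\omega$ is extensional Heyting arithmetic in all finite types (full induction, $\lambda$-abstraction, primitive recursors at all types; quantifier-free fragment Gödel's system $\mathsf{T}$). $\mathbb{B}=\{0,1\}$ is the Boolean type. $X^{\mathbb{N}}$ is the type $\mathbb{N}\to X$. For $\alpha\colon X^{\mathbb{N}}$, $\overline{\alpha}n=\langle\alpha(0),\dots,\alpha(n-1)\rangle$ is the finite sequence of length $n$; for a finite sequence $s$, $\hat s\colon X^{\mathbb{N}}$ extends $s$ by the canonical element $\mathbf{0}_X$. $Z^\dagger$ is the type of finite partial functions from $\mathbb{N}$ to $Z$ with decidable finite domain $\mathrm{dom}(u)$; $\hat u\colon Z^{\mathbb{N}}$ agrees with $u$ on $\mathrm{dom}(u)$ and is $\mathbf{0}_Z$ elsewhere; $\hat\varphi(u):=\varphi(\hat u)$. $\emptyset$ is the nowhere-defined partial function; $u\oplus(n,x)$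 equals $u$ if $n\in\mathrm{dom}(u)$ and otherwise is $u$ extended with value $x$ at $n$. The $\varphi$-thread of $\alpha\colon Z^{\mathbb{N}}$: $[\alpha]^{\varphi}_{0}=\emptyset$, $[\alpha]^{\varphi}_{i+1}=[\alpha]^{\varphi}_{i}\oplus(m_i,\alpha(m_i))$ with $m_i:=\hat\varphi([\alpha]^{\varphi}_{i})$. *)

(* Defs.v *)
From Stdlib Require Import List.
Import ListNotations.

Set Implicit Arguments.
Unset Strict Implicit.
Unset Printing Implicit Defensive.

(** E-HA^omega: intrinsically typed de Bruijn terms (Goedel's T over N, B, products,
    finite sequences and function types), first-order formulas over them, and
    intuitionistic natural deduction. *)

Inductive ty : Type :=
| N : ty
| B : ty
| Prod : ty -> ty -> ty
| Sq : ty -> ty                      (* finite sequences X^* *)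
| Arr : ty -> ty -> ty.

Declare Scope ty_scope.
Delimit Scope ty_scope with ty.
Bind Scope ty_scope with ty.
Notation "X ** Y" := (Prod X Y) (at level 40, left associativity) : ty_scope.
Notation "X ~> Y" := (Arr X Y) (at level 60, right associativity) : ty_scope.
Local Open Scope ty_scope.

Inductive cst : ty -> Type :=
| cZero : cst N
| cSucc : cst (N ~> N)
| cNrec X : cst (X ~> (N ~> X ~> X) ~> N ~> X)
| cTrue : cst B
| cFalse : cst B
| cIf X : cst (B ~> X ~> X ~> X)
| cPair X Y : cst (X ~> Y ~> X ** Y)
| cFst X Y : cst (X ** Y ~> X)
| cSnd X Y : cst (X ** Y ~> Y)
| cNil X : cst (Sq X)
| cCons X : cst (X ~> Sq X ~> Sq X)
| cSrec X Y : cst (Y ~> (X ~> Sq X ~> Y ~> Y) ~> Sq X ~> Y).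

Definition ctx := list ty.

Inductive var : ctx -> ty -> Type :=
| VZ G X : var (X :: G) X
| VS G X Y : var G X -> var (Y :: G) X.
Arguments VZ {G X}.
Arguments VS {G X Y} _.

Inductive tm (G : ctx) : ty -> Type :=
| tvar X : var G X -> tm G X
| tcst X : cst X -> tm G X
| tapp X Y : tm G (X ~> Y) -> tm G X -> tm G Y
| tlam X Y : tm (X :: G) Y -> tm G (X ~> Y).
Arguments tcst {G X} _.

Declare Scope tm_scope.
Delimit Scope tm_scope with tm.
Bind Scope tm_scope with tm.
Notation "f @ x" := (tapp f x) (at level 40, left associativity) : tm_scope.
Notation "'lam' t" := (tlam t) (at level 65, right associativity) : tm_scope.
Local Open Scope tm_scope.

Definition ren (G D : ctx) := forall X, var G X -> var D X.
Definition sub (G D : ctx) := forall X, var G X -> tm D X.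

Definition up_ren G D Y (r : ren G D) : ren (Y :: G) (Y :: D) :=
  fun X x =>
    match x in var G' X' return
      match G' with
      | [] => unit
      | Z :: G0 => ren G0 D -> var (Z :: D) X'
      end
    with
    | VZ => fun _ => VZ
    | VS y => fun r => VS (r _ y)
    end r.

Fixpoint ren_tm G D (r : ren G D) X (t : tm G X) : tm D X :=
  match t with
  | tvar x => tvar (r _ x)
  | tcst c => tcst c
  | tapp f u => tapp (ren_tm r f) (ren_tm r u)
  | tlam u => tlam (ren_tm (up_ren r) u)
  end.

Definition scons G D Y (t : tm D Y) (s : sub G D) : sub (Y :: G) D :=
  fun X x =>
    match x in var G' X' return
      match G' with
      | [] => unit
      | Z :: G0 => tm D Z -> sub G0 D -> tm D X'
      end
    with
    | VZ => fun t _ => t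
    | VS y => fun _ s => s _ y
    end t s.

Definition up G D Y (s : sub G D) : sub (Y :: G) (Y :: D) :=
  scons (tvar VZ) (fun X x => ren_tm (fun _ => VS) (s X x)).

Fixpoint sub_tm G D (s : sub G D) X (t : tm G X) : tm D X :=
  match t with
  | tvar x => s _ x
  | tcst c => tcst c
  | tapp f u => tapp (sub_tm s f) (sub_tm s u)
  | tlam u => tlam (sub_tm (up s) u)
  end.

Definition ids G : sub G G := fun X x => tvar x.
Definition shift1 G Y : sub G (Y :: G) := fun X x => tvar (VS x).
Definition shift2 G Y Z : sub G (Y :: Z :: G) := fun X x => tvar (VS (VS x)).

Definition inst_tm G Y X (t : tm (Y :: G) X) (u : tm G Y) : tm G X :=
  sub_tm (scons u (@ids G)) t.

Notation x0 := (tvar VZ).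
Notation x1 := (tvar (VS VZ)).
Notation x2 := (tvar (VS (VS VZ))).
Notation x3 := (tvar (VS (VS (VS VZ)))).
Notation x4 := (tvar (VS (VS (VS (VS VZ))))).

Section Constants.
Context {G : ctx}.
Definition zero : tm G N := tcst cZero.
Definition succ (n : tm G N) : tm G N := tcst cSucc @ n.
Definition nrec X (a : tm G X) (f : tm G (N ~> X ~> X)) (n : tm G N) : tm G X :=
  tcst (cNrec X) @ a @ f @ n.
Definition true_ : tm G B := tcst cTrue.
Definition false_ : tm G B := tcst cFalse.
Definition if_ X (b : tm G B) (t e : tm G X) : tm G X := tcst (cIf X) @ b @ t @ e.
Definition pair_ X Y (a : tm G X) (b : tm G Y) : tm G (X ** Y) :=
  tcst (cPair X Y) @ a @ b.
Definition fst_ X Y (p : tm G (X ** Y)) : tm G X := tcst (cFst X Y) @ p.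
Definition snd_ X Y (p : tm G (X ** Y)) : tm G Y := tcst (cSnd X Y) @ p.
Definition nil_ X : tm G (Sq X) := tcst (cNil X).
Definition cons_ X (a : tm G X) (s : tm G (Sq X)) : tm G (Sq X) :=
  tcst (cCons X) @ a @ s.
Definition srec X Y (a : tm G Y) (f : tm G (X ~> Sq X ~> Y ~> Y)) (s : tm G (Sq X)) :
  tm G Y := tcst (cSrec X Y) @ a @ f @ s.
End Constants.
Arguments nil_ {G X}.

Inductive form (G : ctx) : Type :=
| fBot : form G
| fEq X : tm G X -> tm G X -> form G
| fAnd : form G -> form G -> form G
| fOr : form G -> form G -> form G
| fImp : form G -> form G -> form G
| fAll X : form (X :: G) -> form G
| fEx X : form (X :: G) -> form G.
Arguments fBot {G}.
Arguments fAll {G} X _.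
Arguments fEx {G} X _.

Declare Scope form_scope.
Delimit Scope form_scope with form.
Bind Scope form_scope with form.
Notation "s == t" := (fEq s%tm t%tm) (at level 70, no associativity) : form_scope.
Notation "A --> C" := (fImp A C) (at level 85, right associativity) : form_scope.
Local Open Scope form_scope.

Fixpoint sub_form G D (s : sub G D) (A : form G) : form D :=
  match A with
  | fBot => fBot
  | fEq t u => fEq (sub_tm s t) (sub_tm s u)
  | fAnd A C => fAnd (sub_form s A) (sub_form s C)
  | fOr A C => fOr (sub_form s A) (sub_form s C)
  | fImp A C => fImp (sub_form s A) (sub_form s C)
  | fAll X A => fAll X (sub_form (up s) A)
  | fEx X A => fEx X (sub_form (up s) A)
  end.

Definition inst G Y (A : form (Y :: G)) (u : tm G Y) : form G :=
  sub_form (scons u (@ids G)) A.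
Definition wk G Y (A : form G) : form (Y :: G) := sub_form (@shift1 G Y) A.

(** [EHA H A]: the formula [A] is derivable in E-HA^omega from the hypotheses [H].
    Equality is primitive at every type and extensional at function types.
    For a sentence [A], "E-HA^omega + A proves C" is [EHA [A] C]. *)
Inductive EHA : forall G, list (form G) -> form G -> Prop :=
| EHA_hyp G (H : list (form G)) A : In A H -> EHA H A
| EHA_botE G (H : list (form G)) A : EHA H fBot -> EHA H A
| EHA_andI G (H : list (form G)) A C : EHA H A -> EHA H C -> EHA H (fAnd A C)
| EHA_andEl G (H : list (form G)) A C : EHA H (fAnd A C) -> EHA H A
| EHA_andEr G (H : list (form G)) A C : EHA H (fAnd A C) -> EHA H C
| EHA_orIl G (H : list (form G)) A C : EHA H A -> EHA H (fOr A C)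
| EHA_orIr G (H : list (form G)) A C : EHA H C -> EHA H (fOr A C)
| EHA_orE G (H : list (form G)) A C D :
    EHA H (fOr A C) -> EHA (A :: H) D -> EHA (C :: H) D -> EHA H D
| EHA_impI G (H : list (form G)) A C : EHA (A :: H) C -> EHA H (A --> C)
| EHA_impE G (H : list (form G)) A C : EHA H (A --> C) -> EHA H A -> EHA H C
| EHA_allI G (H : list (form G)) X (A : form (X :: G)) :
    EHA (map (@wk G X) H) A -> EHA H (fAll X A)
| EHA_allE G (H : list (form G)) X (A : form (X :: G)) t :
    EHA H (fAll X A) -> EHA H (inst A t)
| EHA_exI G (H : list (form G)) X (A : form (X :: G)) t :
    EHA H (inst A t) -> EHA H (fEx X A)
| EHA_exE G (H : list (form G)) X (A : form (X :: G)) C :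
    EHA H (fEx X A) -> EHA (A :: map (@wk G X) H) (wk X C) -> EHA H C
| EHA_refl G (H : list (form G)) X (t : tm G X) : EHA H (t == t)
| EHA_leibniz G (H : list (form G)) X (A : form (X :: G)) t u :
    EHA H (t == u) -> EHA H (inst A t) -> EHA H (inst A u)
| EHA_ext G (H : list (form G)) X Y (f g : tm G (X ~> Y)) :
    EHA H (fAll X (sub_tm (@shift1 G X) f @ x0 == sub_tm (@shift1 G X) g @ x0)) ->
    EHA H (f == g)
| EHA_beta G (H : list (form G)) X Y (t : tm (X :: G) Y) u :
    EHA H ((lam t) @ u == inst_tm t u)
| EHA_fst G (H : list (form G)) X Y (a : tm G X) (b : tm G Y) :
    EHA H (fst_ (pair_ a b) == a)
| EHA_snd G (H : list (form G)) X Y (a : tm G X) (b : tm G Y) :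
    EHA H (snd_ (pair_ a b) == b)
| EHA_surj G (H : list (form G)) X Y (p : tm G (X ** Y)) :
    EHA H (pair_ (fst_ p) (snd_ p) == p)
| EHA_true_false G (H : list (form G)) : EHA H (true_ == false_ --> fBot)
| EHA_if_true G (H : list (form G)) X (a b : tm G X) : EHA H (if_ true_ a b == a)
| EHA_if_false G (H : list (form G)) X (a b : tm G X) : EHA H (if_ false_ a b == b)
| EHA_bool_ind G (H : list (form G)) (A : form (B :: G)) t :
    EHA H (inst A true_) -> EHA H (inst A false_) -> EHA H (inst A t)
| EHA_succ_zero G (H : list (form G)) n : EHA H (succ n == zero --> fBot)
| EHA_succ_inj G (H : list (form G)) m n : EHA H (succ m == succ n --> m == n)
| EHA_nrec_zero G (H : list (form G)) X (a : tm G X) f :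
    EHA H (nrec a f zero == a)
| EHA_nrec_succ G (H : list (form G)) X (a : tm G X) f n :
    EHA H (nrec a f (succ n) == f @ n @ nrec a f n)
| EHA_nat_ind G (H : list (form G)) (A : form (N :: G)) t :
    EHA H (inst A zero) ->
    EHA H (fAll N (A --> sub_form (scons (succ x0) (@shift1 G N)) A)) ->
    EHA H (inst A t)
| EHA_srec_nil G (H : list (form G)) X Y (a : tm G Y) f :
    EHA H (srec (X := X) a f nil_ == a)
| EHA_srec_cons G (H : list (form G)) X Y (a : tm G Y) f (x : tm G X) s :
    EHA H (srec a f (cons_ x s) == f @ x @ s @ srec a f s)
| EHA_seq_ind G (H : list (form G)) X (A : form (Sq X :: G)) t :
    EHA H (inst A nil_) ->
    EHA H (fAll X (fAll (Sq X)
      (sub_form (scons x0 (@shift2 G (Sq X) X)) A -->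
       sub_form (scons (cons_ x1 x0) (@shift2 G (Sq X) X)) A))) ->
    EHA H (inst A t).

(** The canonical element 0_X. *)
Fixpoint canon {G} (X : ty) : tm G X :=
  match X with
  | N => zero
  | B => false_
  | Prod Y Z => pair_ (canon Y) (canon Z)
  | Sq Y => nil_
  | Arr Y Z => lam (canon Z)
  end.

(** eqN 0 n = [n = 0],  eqN (m+1) 0 = false,  eqN (m+1) (n+1) = eqN m n. *)
Definition eqN {G} : tm G (N ~> N ~> B) :=
  lam nrec (lam nrec true_ (lam lam false_) x0)
           (lam lam lam nrec false_ (lam lam x3 @ x1) x0)
           x0.

(** ltN 0 n = [n <> 0],  ltN (m+1) 0 = false,  ltN (m+1) (n+1) = ltN m n. *)
Definition ltN {G} : tm G (N ~> N ~> B) :=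
  lam nrec (lam nrec false_ (lam lam true_) x0)
           (lam lam lam nrec false_ (lam lam x3 @ x1) x0)
           x0.

(** initseg alpha 0 = <>,
    initseg alpha (n+1) = alpha 0 :: initseg (fun i => alpha (i+1)) n. *)
Definition initseg {G} X : tm G ((N ~> X) ~> N ~> Sq X) :=
  lam lam nrec (lam nil_)
               (lam lam lam cons_ (x0 @ zero) (x1 @ (lam x1 @ succ x0)))
               x0 @ x1.

(** seqhat <> i = 0_X,  seqhat (x :: s) 0 = x,  seqhat (x :: s) (i+1) = seqhat s i. *)
Definition seqhat {G} X : tm G (Sq X ~> N ~> X) :=
  lam srec (lam canon X)
           (lam lam lam lam nrec x3 (lam lam x3 @ x1) x0)
           x0.

(** Z^dagger: a finite partial function from N to Z is given by a finite list of
    pairs (argument, value); if an argument is listed twice, the first entry counts. *)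
Definition pfun (Z : ty) : ty := Sq (N ** Z).

Definition pempty {G} Z : tm G (pfun Z) := nil_.

(** dom <> n = false,  dom ((m,z) :: u) n = if m = n then true else dom u n. *)
Definition dom {G} Z : tm G (pfun Z ~> N ~> B) :=
  lam srec (lam false_)
           (lam lam lam lam if_ (eqN @ fst_ x3 @ x0) true_ (x1 @ x0))
           x0.

(** pfunhat <> n = 0_Z,  pfunhat ((m,z) :: u) n = if m = n then z else pfunhat u n. *)
Definition pfunhat {G} Z : tm G (pfun Z ~> N ~> Z) :=
  lam srec (lam canon Z)
           (lam lam lam lam if_ (eqN @ fst_ x3 @ x0) (snd_ x3) (x1 @ x0))
           x0.

(** u (+) (n,x), as a function of u and the pair. *)
Definition oplus {G} Z : tm G (pfun Z ~> N ** Z ~> pfun Z) :=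
  lam lam if_ (dom Z @ x1 @ fst_ x0) x1 (cons_ x0 x1).

(** thread phi alpha i = [alpha]^phi_i. *)
Definition thread {G} Z : tm G (((N ~> Z) ~> N) ~> (N ~> Z) ~> N ~> pfun Z) :=
  lam lam lam
    nrec (pempty Z)
         (lam lam
            (lam oplus Z @ x1 @ pair_ x0 (x4 @ x0)) @ (x4 @ (pfunhat Z @ x0)))
         x0.

Definition Spec (X : ty) : form [] :=
  fAll ((N ~> X) ~> N) (fAll (N ~> X) (fEx N
    (ltN @ (x2 @ (seqhat X @ (initseg X @ x1 @ x0))) @ x0 == true_))).

Definition sSpec (Z : ty) : form [] :=
  fAll ((N ~> Z) ~> N) (fAll (N ~> Z) (fEx N
    (dom Z @ (thread Z @ x2 @ x1 @ x0)
           @ (x2 @ (pfunhat Z @ (thread Z @ x2 @ x1 @ x0))) == true_))).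

(* Main.v *)
(** Given [phi] and [a], put [b i = (a i, true)] and let [psi c] count upwards from 0, at
    most [phi (fst o c)] times, as long as the Boolean component of [c] is [true].  The
    canonical Boolean is [false], so for a partial function with values taken from [b]
    the Boolean component of its total extension is the characteristic function of its
    domain.  Hence, as long as [phi] has not met the stopping condition of [Spec X],
    [psi] asks for the first undefined place, and the [n]-th element of the
    [psi]-thread of [b] is the initial segment of [b] of length [n].  When [sSpec]
    makes [psi] return a point below [n], the count was cut off by its bound, so
    the value of [phi] at the initial segment of [a] of length [n] is below [n]. *)

Require Import Defs.
From Stdlib Require Import List.
(* Not imported: the notation [-->] of [Morphisms] clashes with the one of [Defs]. *)
From Stdlib Require Setoid Morphisms.
Import Corelib.Classes.RelationClasses.
Import ListNotations.
Set Implicit Arguments.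
Unset Strict Implicit.
Unset Printing Implicit Defensive.
Local Open Scope ty_scope.
Local Open Scope tm_scope.
Local Open Scope form_scope.

(** * Renaming and substitution on terms *)

(** The motive is computed from the context index and is trivial on the empty context; [P] and its
    two hypotheses pass through the match to be retyped in each branch. *)
Lemma var_caseP Y G (P : forall X, var (Y :: G) X -> Prop) :
  P Y VZ -> (forall X (x : var G X), P X (VS x)) -> forall X (x : var (Y :: G) X), P X x.
Proof.
intros HZ HS X x.
exact (match x in var G' X' return
         match G' return var G' X' -> Prop with
         | [] => fun _ => True
         | Y0 :: G0 => fun v => forall P : forall X, var (Y0 :: G0) X -> Prop,
             P Y0 VZ -> (forall X (x : var G0 X), P X (VS x)) -> P X' v
         end x with
       | VZ => fun P HZ HS => HZ
       | VS y => fun P HZ HS => HS _ y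
       end P HZ HS).
Qed.

Lemma ren_tm_ext G D (r r' : ren G D) :
  (forall X x, r X x = r' X x) -> forall X (t : tm G X), ren_tm r t = ren_tm r' t.
Proof.
intros E X t; revert D r r' E.
induction t; intros D r r' E; cbn; f_equal; auto.
apply IHt; apply var_caseP; cbn; congruence.
Qed.

Lemma sub_tm_ext G D (s s' : sub G D) :
  (forall X x, s X x = s' X x) -> forall X (t : tm G X), sub_tm s t = sub_tm s' t.
Proof.
intros E X t; revert D s s' E.
induction t; intros D s s' E; cbn; f_equal; auto.
apply IHt; apply var_caseP; cbn; congruence.
Qed.

Lemma sub_tm_ids G X (t : tm G X) : sub_tm (@ids G) t = t.
Proof.
induction t; cbn; f_equal; auto.
rewrite <- IHt at 2; apply sub_tm_ext; apply var_caseP; reflexivity.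
Qed.

Lemma ren_ren_tm G D E (r : ren G D) (q : ren D E) X (t : tm G X) :
  ren_tm q (ren_tm r t) = ren_tm (fun Y y => q Y (r Y y)) t.
Proof.
revert D E r q; induction t; intros D E r q; cbn; f_equal; auto.
rewrite IHt; apply ren_tm_ext; apply var_caseP; reflexivity.
Qed.

Lemma sub_ren_tm G D E (r : ren G D) (s : sub D E) X (t : tm G X) :
  sub_tm s (ren_tm r t) = sub_tm (fun Y y => s Y (r Y y)) t.
Proof.
revert D E r s; induction t; intros D E r s; cbn; f_equal; auto.
rewrite IHt; apply sub_tm_ext; apply var_caseP; reflexivity.
Qed.

Lemma ren_sub_tm G D E (s : sub G D) (r : ren D E) X (t : tm G X) :
  ren_tm r (sub_tm s t) = sub_tm (fun Y y => ren_tm r (s Y y)) t.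
Proof.
revert D E r s; induction t; intros D E r s; cbn; f_equal; auto.
rewrite IHt; apply sub_tm_ext; apply var_caseP; [reflexivity|].
intros; cbn; now rewrite !ren_ren_tm.
Qed.

(** With [sub_up_ren_tm], this carries substitutions past weakened parameters such as [phi] and [a]
    under binders. *)
Lemma sub_scons_ren_tm G D Y (u : tm D Y) (s : sub G D) X (t : tm G X) :
  sub_tm (scons u s) (ren_tm (fun _ => VS) t) = sub_tm s t.
Proof. now rewrite sub_ren_tm. Qed.

Lemma sub_up_ren_tm G D Y (s : sub G D) X (t : tm G X) :
  sub_tm (@up G D Y s) (ren_tm (fun _ => VS) t) = ren_tm (fun _ => VS) (sub_tm s t).
Proof. now rewrite sub_ren_tm, ren_sub_tm. Qed.

Lemma sub_tm_shift1 G Y X (t : tm G X) :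
  sub_tm (@shift1 G Y) t = ren_tm (fun _ => VS) t.
Proof. rewrite <- (sub_tm_ids t) at 2; now rewrite ren_sub_tm. Qed.

Arguments up G D Y s X x /.
Arguments scons G D Y t s X !x /.
Arguments up_ren G D Y r X !x /.
Arguments ids G X x /.
Arguments shift1 G Y X x /.

Lemma sub_canon X G D (s : sub G D) : sub_tm s (canon X) = canon X.
Proof. revert G D s; induction X; intros G D s; cbn; now rewrite ?IHX1, ?IHX2. Qed.

Lemma canon_prod G X Y : @canon G (X ** Y) = pair_ (canon X) (canon Y).
Proof. reflexivity. Qed.
Lemma canon_B G : @canon G B = false_.
Proof. reflexivity. Qed.

Ltac closed K := unfold K; cbn; rewrite ?sub_canon; reflexivity.

(** * Closed terms for the construction and their invariance under substitution *)

Definition pw_fst {G} X Y : tm G ((N ~> X ** Y) ~> N ~> X) := lam lam fst_ (x1 @ x0).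
Definition pw_snd {G} X Y : tm G ((N ~> X ** Y) ~> N ~> Y) := lam lam snd_ (x1 @ x0).
Definition below {G} : tm G (N ~> N ~> B) := lam lam ltN @ x0 @ x1.
Definition update {G} X : tm G ((N ~> X) ~> N ~> X ~> N ~> X) :=
  lam lam lam lam if_ (eqN @ x2 @ x0) x1 (x3 @ x0).
Definition tag {G} X : tm G ((N ~> X) ~> N ~> X ** B) := lam lam pair_ (x1 @ x0) true_.
Definition tl {G} X : tm G ((N ~> X) ~> N ~> X) := lam lam x1 @ succ x0.
(** The least [i] at which the predicate is false, or the bound if there is none below it. The
    recursion on the bound shifts the predicate, hence the recursor at type [(N ~> B) ~> N]. *)
Definition search {G} : tm G (N ~> (N ~> B) ~> N) :=
  lam nrec (lam zero) (lam lam lam if_ (x0 @ zero) (succ (x1 @ (tl B @ x0))) zero) x0.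
Definition query {G} X : tm G (((N ~> X) ~> N) ~> (N ~> X ** B) ~> N) :=
  lam lam search @ (x1 @ (pw_fst X B @ x0)) @ (pw_snd X B @ x0).

Section SubstClosed.
Context (G D : ctx) (s : sub G D).
Lemma sub_eqN : sub_tm s eqN = eqN. Proof. closed (@eqN). Qed.
Lemma sub_ltN : sub_tm s ltN = ltN. Proof. closed (@ltN). Qed.
Lemma sub_initseg X : sub_tm s (initseg X) = initseg X. Proof. closed (@initseg). Qed.
Lemma sub_seqhat X : sub_tm s (seqhat X) = seqhat X. Proof. closed (@seqhat). Qed.
Lemma sub_pw_fst X Y : sub_tm s (pw_fst X Y) = pw_fst X Y. Proof. closed (@pw_fst). Qed.
Lemma sub_pw_snd X Y : sub_tm s (pw_snd X Y) = pw_snd X Y. Proof. closed (@pw_snd). Qed.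
Lemma sub_tag X : sub_tm s (tag X) = tag X. Proof. closed (@tag). Qed.
Lemma sub_tl X : sub_tm s (tl X) = tl X. Proof. closed (@tl). Qed.
Lemma sub_dom X : sub_tm s (dom X) = dom X. Proof. closed (@dom). Qed.
Lemma sub_pfunhat X : sub_tm s (pfunhat X) = pfunhat X. Proof. closed (@pfunhat). Qed.
Lemma sub_below : sub_tm s below = below. Proof. closed (@below). Qed.
Lemma sub_update X : sub_tm s (update X) = update X. Proof. closed (@update). Qed.
Lemma sub_search : sub_tm s search = search. Proof. closed (@search). Qed.
Lemma sub_query X : sub_tm s (query X) = query X. Proof. closed (@query). Qed.
Lemma sub_oplus X : sub_tm s (oplus X) = oplus X. Proof. closed (@oplus). Qed.
Lemma sub_thread X : sub_tm s (thread X) = thread X. Proof. closed (@thread). Qed.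
End SubstClosed.

(* The subject is matched syntactically: [rewrite] would unify [canon ?X] with closed
   terms such as [lam false_]. *)
Ltac push_sub := match goal with |- context [@sub_tm ?G ?D ?s ?T ?t] =>
  let to u := (change (@sub_tm G D s T t) with u) in
  (* Types are first converted: [pfun Z] and [Sq (N ** Z)] both occur as indices. *)
  let by_eq E :=
    (match type of E with ?l = _ => change (@sub_tm G D s T t) with l end; rewrite E) in
  lazymatch t with
  | @ren_tm _ _ _ _ ?u =>
      first [rewrite (@sub_scons_ren_tm _ _ _ _ _ _ u) | rewrite (@sub_up_ren_tm _ _ _ _ _ u)
           | by_eq (sub_tm_ids t)]
  | zero => to (@zero D)
  | true_ => to (@true_ D)
  | false_ => to (@false_ D)
  | pempty ?X => to (@pempty D X)
  | @nil_ _ ?X => to (@nil_ D X)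
  | succ ?n => to (succ (sub_tm s n))
  | nrec ?a ?f ?n => to (nrec (sub_tm s a) (sub_tm s f) (sub_tm s n))
  | srec ?a ?f ?l => to (srec (sub_tm s a) (sub_tm s f) (sub_tm s l))
  | if_ ?b ?a ?e => to (if_ (sub_tm s b) (sub_tm s a) (sub_tm s e))
  | pair_ ?a ?b => to (pair_ (sub_tm s a) (sub_tm s b))
  | fst_ ?p => to (fst_ (sub_tm s p))
  | snd_ ?p => to (snd_ (sub_tm s p))
  | cons_ ?a ?l => to (cons_ (sub_tm s a) (sub_tm s l))
  | canon ?X => by_eq (sub_canon X s)
  | eqN => by_eq (sub_eqN s)
  | ltN => by_eq (sub_ltN s)
  | below => by_eq (sub_below s)
  | search => by_eq (sub_search s)
  | initseg ?X => by_eq (sub_initseg s X)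
  | seqhat ?X => by_eq (sub_seqhat s X)
  | dom ?X => by_eq (sub_dom s X)
  | pfunhat ?X => by_eq (sub_pfunhat s X)
  | oplus ?X => by_eq (sub_oplus s X)
  | thread ?X => by_eq (sub_thread s X)
  | tag ?X => by_eq (sub_tag s X)
  | tl ?X => by_eq (sub_tl s X)
  | update ?X => by_eq (sub_update s X)
  | query ?X => by_eq (sub_query s X)
  | pw_fst ?X ?Y => by_eq (sub_pw_fst s X Y)
  | pw_snd ?X ?Y => by_eq (sub_pw_snd s X Y)
  | _ => lazymatch s with
    | @ids _ => by_eq (sub_tm_ids t)
    | @shift1 _ ?Y => by_eq (sub_tm_shift1 Y t)
    end
  end end.
Ltac nrm := unfold inst, inst_tm, wk;
  cbn [sub_form sub_tm ren_tm scons up up_ren ids shift1 map];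
  repeat (push_sub; cbn [sub_tm ren_tm scons up up_ren ids shift1]).

(** * Derivable equality as a congruence *)

Local Notation "R ==> S" := (Morphisms.respectful R S) (at level 55, right associativity).

(** As a relation on terms with [H] fixed, derivable equality admits setoid rewriting, which then
    builds equational derivations inside the object theory. *)
Definition eqt G (H : list (form G)) X (t u : tm G X) : Prop := EHA H (t == u).
Arguments eqt {G} H {X} t u.

Lemma eqt_leibniz G (H : list (form G)) X (A : form (X :: G)) t u :
  eqt H t u -> EHA H (inst A t) -> EHA H (inst A u).
Proof. apply EHA_leibniz. Qed.

Instance eqt_equiv G (H : list (form G)) X : Equivalence (@eqt G H X).
Proof.
assert (S : Symmetric (@eqt G H X)).
{ intros t u E.
  (* The formula [x0 == t] is reflexivity at [t] and the reversed equation at [u]. *)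
  pose proof (eqt_leibniz (A := x0 == ren_tm (fun _ => VS) t) E) as L.
  unfold inst in L; revert L; nrm; intro L; apply L, EHA_refl. }
split; [intro t; apply EHA_refl | exact S |].
intros t u v E F.
pose proof (eqt_leibniz (A := ren_tm (fun _ => VS) t == x0) F) as L.
revert L; nrm; intro L; exact (L E).
Qed.

Instance tapp_eqt G (H : list (form G)) X Y :
  Morphisms.Proper (eqt H ==> eqt H ==> eqt H) (@tapp G X Y).
Proof.
intros f g E t u F.
transitivity (g @ t).
- pose proof (eqt_leibniz
    (A := ren_tm (fun _ => VS) f @ ren_tm (fun _ => VS) t == x0 @ ren_tm (fun _ => VS) t) E) as L.
  revert L; nrm; intro L; apply L, EHA_refl.
- pose proof (eqt_leibniz
    (A := ren_tm (fun _ => VS) g @ ren_tm (fun _ => VS) t == ren_tm (fun _ => VS) g @ x0) F) as L.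
  revert L; nrm; intro L; apply L, EHA_refl.
Qed.

Ltac proper := repeat intro; unfold succ, if_, pair_, fst_, snd_, cons_;
  repeat (apply tapp_eqt; [|assumption]); try reflexivity.
Section Congruence.
Context (G : ctx) (H : list (form G)).
Global Instance succ_eqt : Morphisms.Proper (eqt H ==> eqt H) (@succ G).
Proof. proper. Qed.
Global Instance if_eqt X : Morphisms.Proper (eqt H ==> eqt H ==> eqt H ==> eqt H) (@if_ G X).
Proof. proper. Qed.
Global Instance pair_eqt X Y : Morphisms.Proper (eqt H ==> eqt H ==> eqt H) (@pair_ G X Y).
Proof. proper. Qed.
Global Instance fst_eqt X Y : Morphisms.Proper (eqt H ==> eqt H) (@fst_ G X Y).
Proof. proper. Qed.
Global Instance snd_eqt X Y : Morphisms.Proper (eqt H ==> eqt H) (@snd_ G X Y).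
Proof. proper. Qed.
Global Instance cons_eqt X : Morphisms.Proper (eqt H ==> eqt H ==> eqt H) (@cons_ G X).
Proof. proper. Qed.
End Congruence.

Lemma beta_eqt G (H : list (form G)) X Y (t : tm (X :: G) Y) u :
  eqt H ((lam t) @ u) (inst_tm t u).
Proof. apply EHA_beta. Qed.

(* The context is fixed because there is no congruence rule under [lam]. *)
Ltac beta := repeat (match goal with |- @eqt ?G ?H _ _ _ => rewrite (@beta_eqt G H) end; nrm).

(** * Computation rules of the defined terms *)

Section Rules.
Context (G : ctx) (H : list (form G)).
Lemma nrec0 X (a : tm G X) f : eqt H (nrec a f zero) a.
Proof. apply EHA_nrec_zero. Qed.
Lemma nrecS X (a : tm G X) f n : eqt H (nrec a f (succ n)) (f @ n @ nrec a f n).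
Proof. apply EHA_nrec_succ. Qed.
Lemma srec_nil X Y (a : tm G Y) f : eqt H (srec (X := X) a f nil_) a.
Proof. apply EHA_srec_nil. Qed.
Lemma srec_cons X Y (a : tm G Y) f (x : tm G X) s :
  eqt H (srec a f (cons_ x s)) (f @ x @ s @ srec a f s).
Proof. apply EHA_srec_cons. Qed.
Lemma if_true X (a b : tm G X) : eqt H (if_ true_ a b) a.
Proof. apply EHA_if_true. Qed.
Lemma if_false X (a b : tm G X) : eqt H (if_ false_ a b) b.
Proof. apply EHA_if_false. Qed.
Lemma fst_pair X Y (a : tm G X) (b : tm G Y) : eqt H (fst_ (pair_ a b)) a.
Proof. apply EHA_fst. Qed.
Lemma snd_pair X Y (a : tm G X) (b : tm G Y) : eqt H (snd_ (pair_ a b)) b.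
Proof. apply EHA_snd. Qed.

Lemma eqN00 : eqt H (eqN @ zero @ zero) true_.
Proof. unfold eqN; beta. rewrite nrec0. beta. now rewrite nrec0. Qed.
Lemma eqN0S n : eqt H (eqN @ zero @ succ n) false_.
Proof. unfold eqN; beta. rewrite nrec0; beta. rewrite nrecS; beta. reflexivity. Qed.
Lemma eqNS0 n : eqt H (eqN @ succ n @ zero) false_.
Proof. unfold eqN; beta. rewrite nrecS; beta. now rewrite nrec0. Qed.
Lemma eqNSS m n : eqt H (eqN @ succ m @ succ n) (eqN @ m @ n).
Proof. unfold eqN; beta. rewrite nrecS; beta. rewrite nrecS; beta. reflexivity. Qed.

Lemma ltN00 : eqt H (ltN @ zero @ zero) false_.
Proof. unfold ltN; beta. rewrite nrec0; beta. now rewrite nrec0. Qed.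
Lemma ltN0S n : eqt H (ltN @ zero @ succ n) true_.
Proof. unfold ltN; beta. rewrite nrec0; beta. rewrite nrecS; beta. reflexivity. Qed.
Lemma ltNS0 n : eqt H (ltN @ succ n @ zero) false_.
Proof. unfold ltN; beta. rewrite nrecS; beta. now rewrite nrec0. Qed.
Lemma ltNSS m n : eqt H (ltN @ succ m @ succ n) (ltN @ m @ n).
Proof. unfold ltN; beta. rewrite nrecS; beta. rewrite nrecS; beta. reflexivity. Qed.

Lemma pw_fstE X Y (b : tm G (N ~> X ** Y)) i : eqt H (pw_fst X Y @ b @ i) (fst_ (b @ i)).
Proof. unfold pw_fst; beta. reflexivity. Qed.
Lemma pw_sndE X Y (b : tm G (N ~> X ** Y)) i : eqt H (pw_snd X Y @ b @ i) (snd_ (b @ i)).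
Proof. unfold pw_snd; beta. reflexivity. Qed.
Lemma belowE n i : eqt H (below @ n @ i) (ltN @ i @ n).
Proof. unfold below; beta. reflexivity. Qed.
Lemma updateE X (f : tm G (N ~> X)) n z i :
  eqt H (update X @ f @ n @ z @ i) (if_ (eqN @ n @ i) z (f @ i)).
Proof. unfold update; beta. reflexivity. Qed.
Lemma tagE X (a : tm G (N ~> X)) i : eqt H (tag X @ a @ i) (pair_ (a @ i) true_).
Proof. unfold tag; beta. reflexivity. Qed.
Lemma tlE X (a : tm G (N ~> X)) i : eqt H (tl X @ a @ i) (a @ succ i).
Proof. unfold tl; beta. reflexivity. Qed.

Lemma search0 b : eqt H (search @ zero @ b) zero.
Proof. unfold search; beta. rewrite nrec0; beta. reflexivity. Qed.
Lemma searchS k b :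
  eqt H (search @ succ k @ b) (if_ (b @ zero) (succ (search @ k @ (tl B @ b))) zero).
Proof. unfold search; beta. rewrite nrecS; beta. reflexivity. Qed.
Lemma queryE X (phi : tm G ((N ~> X) ~> N)) b :
  eqt H (query X @ phi @ b) (search @ (phi @ (pw_fst X B @ b)) @ (pw_snd X B @ b)).
Proof. unfold query; beta. reflexivity. Qed.

Lemma initseg0 X (a : tm G (N ~> X)) : eqt H (initseg X @ a @ zero) nil_.
Proof. unfold initseg; beta. rewrite nrec0; beta. reflexivity. Qed.
Lemma seqhat_nil X i : eqt H (seqhat X @ nil_ @ i) (canon X).
Proof. unfold seqhat; beta. rewrite srec_nil; beta. reflexivity. Qed.
Lemma seqhat_cons0 X (x : tm G X) s : eqt H (seqhat X @ cons_ x s @ zero) x.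
Proof. unfold seqhat; beta. rewrite srec_cons; beta. now rewrite nrec0. Qed.
Lemma seqhat_consS X (x : tm G X) s i :
  eqt H (seqhat X @ cons_ x s @ succ i) (seqhat X @ s @ i).
Proof. unfold seqhat; beta. rewrite srec_cons; beta. rewrite nrecS; beta. reflexivity. Qed.
Lemma dom_nil Z i : eqt H (dom Z @ nil_ @ i) false_.
Proof. unfold dom; beta. rewrite srec_nil; beta. reflexivity. Qed.
Lemma dom_consE Z (p : tm G (N ** Z)) u i :
  eqt H (dom Z @ cons_ p u @ i) (if_ (eqN @ fst_ p @ i) true_ (dom Z @ u @ i)).
Proof. unfold dom; beta. rewrite srec_cons; beta. reflexivity. Qed.
Lemma pfunhat_nil Z i : eqt H (pfunhat Z @ nil_ @ i) (canon Z).
Proof. unfold pfunhat; beta. rewrite srec_nil; beta. reflexivity. Qed.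
Lemma pfunhat_consE Z (p : tm G (N ** Z)) u i :
  eqt H (pfunhat Z @ cons_ p u @ i) (if_ (eqN @ fst_ p @ i) (snd_ p) (pfunhat Z @ u @ i)).
Proof. unfold pfunhat; beta. rewrite srec_cons; beta. reflexivity. Qed.
Lemma oplusE Z (u : tm G (pfun Z)) p :
  eqt H (oplus Z @ u @ p) (if_ (dom Z @ u @ fst_ p) u (cons_ p u)).
Proof. unfold oplus; beta. reflexivity. Qed.
Lemma thread0 Z (phi : tm G ((N ~> Z) ~> N)) a : eqt H (thread Z @ phi @ a @ zero) nil_.
Proof. unfold thread; beta. now rewrite nrec0. Qed.
(** The value of the query is abstracted into [m], so that a known value can replace both of its
    occurrences at once. *)
Lemma threadS Z (phi : tm G ((N ~> Z) ~> N)) a n m :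
  eqt H (phi @ (pfunhat Z @ (thread Z @ phi @ a @ n))) m ->
  eqt H (thread Z @ phi @ a @ succ n) (oplus Z @ (thread Z @ phi @ a @ n) @ pair_ m (a @ m)).
Proof.
intros <-. unfold thread; beta. rewrite nrecS; beta. reflexivity.
Qed.
End Rules.

(** * Extensionality, case distinction and induction in the object theory *)

(** The premise ranges over all lists [H'], so the weakened hypotheses never have to be computed. *)
Lemma ext_eqt G (H : list (form G)) X Y (f g : tm G (X ~> Y)) :
  (forall H', eqt H' (sub_tm (@shift1 G X) f @ x0) (sub_tm (@shift1 G X) g @ x0)) -> eqt H f g.
Proof. intro E; apply EHA_ext, EHA_allI, E. Qed.

Lemma initsegS G (H : list (form G)) X (a : tm G (N ~> X)) n :
  eqt H (initseg X @ a @ succ n) (cons_ (a @ zero) (initseg X @ (tl X @ a) @ n)).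
Proof.
(* The recursor produces the shifted sequence as an explicit abstraction, which [E] folds back into
   [tl]. *)
assert (E : eqt H (tl X @ a) (lam ren_tm (fun _ => VS) a @ succ x0)).
{ unfold tl; beta. reflexivity. }
unfold initseg; beta. rewrite nrecS; beta. now rewrite E.
Qed.

(** Boolean induction makes equality with [true_] or [false_] decidable; each branch also gets its
    new hypothesis as an [eqt], ready for rewriting. *)
Lemma bool_cases G (H : list (form G)) (b : tm G B) C :
  (eqt ((b == true_) :: H) b true_ -> EHA ((b == true_) :: H) C) ->
  (eqt ((b == false_) :: H) b false_ -> EHA ((b == false_) :: H) C) -> EHA H C.
Proof.
intros Ht Hf.
assert (D : EHA H (inst (fOr (x0 == true_) (x0 == false_)) b)).
{ apply EHA_bool_ind; nrm; [apply EHA_orIl | apply EHA_orIr]; apply EHA_refl. }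
refine (EHA_orE D _ _); [apply Ht | apply Hf]; apply EHA_hyp; now left.
Qed.

Lemma absurd_bool G (H : list (form G)) (b : tm G B) C :
  eqt H b true_ -> eqt H b false_ -> EHA H C.
Proof.
intros Et Ef. apply EHA_botE. apply (EHA_impE (EHA_true_false H)).
change (eqt H true_ false_). now rewrite <- Et.
Qed.

Ltac to_eqt := match goal with |- EHA ?H (fEq ?t ?u) => change (eqt H t u) end.
(* Setoid rewriting must not see the terms inside the list of hypotheses. *)
Ltac hide_hyps := try to_eqt; match goal with |- eqt ?H _ _ => generalize H; intro end.
(** [A] is the goal abstracted over [t]; it is passed explicitly because unification cannot recover
    it from its substitution instance. *)
Ltac induct A t :=
  match goal with |- EHA ?H _ => let J := fresh in
    assert (J : EHA H (inst A t)); [|now revert J; nrm] end;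
  apply EHA_nat_ind; [nrm | apply EHA_allI, EHA_impI; nrm].

Lemma ltN_0r G (H : list (form G)) i : eqt H (ltN @ i @ zero) false_.
Proof.
red; induct (ltN @ x0 @ zero == @false_ (N :: G)) i; [apply ltN00 | apply ltNS0].
Qed.

Lemma ltN_irrefl G (H : list (form G)) n : eqt H (ltN @ n @ n) false_.
Proof.
red; induct (ltN @ x0 @ x0 == @false_ (N :: G)) n; [apply ltN00|].
to_eqt; etransitivity; [hide_hyps; apply ltNSS | apply EHA_hyp; now left].
Qed.

(** * Equations by double recursion with a varying parameter *)

Section DoubleRecursion.
Variables (P Z : ty) (F F' : forall D, tm D P -> tm D N -> tm D N -> tm D Z).
Variable (next : forall D, tm D P -> tm D P).
Hypothesis sub_F : forall D E (s : sub D E) p n i,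
  sub_tm s (F p n i) = F (sub_tm s p) (sub_tm s n) (sub_tm s i).
Hypothesis sub_F' : forall D E (s : sub D E) p n i,
  sub_tm s (F' p n i) = F' (sub_tm s p) (sub_tm s n) (sub_tm s i).
Hypothesis eq00 : forall D (K : list (form D)) p, eqt K (F p zero zero) (F' p zero zero).
Hypothesis eq0S : forall D (K : list (form D)) p i,
  eqt K (F p zero (succ i)) (F' p zero (succ i)).
Hypothesis eqS0 : forall D (K : list (form D)) p n,
  eqt K (F p (succ n) zero) (F' p (succ n) zero).
Hypothesis eqSS : forall D (K : list (form D)) p n i,
  eqt K (F (next p) n i) (F' (next p) n i) ->
  eqt K (F p (succ n) (succ i)) (F' p (succ n) (succ i)).

(** Induction on [n] with [p] and [i] quantified inside, since the step passes from [p] to [next p];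
    then a distinction of zero and successor for [i]. [F] and [F'] are families over all contexts,
    and [sub_F], [sub_F'] make them behave like open terms. *)
Lemma double_rec G (H : list (form G)) p n i : eqt H (F p n i) (F' p n i).
Proof.
assert (A : EHA H (inst (fAll P (fAll N (@F (N :: P :: N :: G) x1 x2 x0 == F' x1 x2 x0))) n)).
{ apply EHA_nat_ind; [|apply EHA_allI, EHA_impI]; nrm; apply EHA_allI, EHA_allI;
    rewrite ?sub_F, ?sub_F'; nrm.
  - match goal with |- EHA ?K _ =>
      assert (A : EHA K (inst (@F (N :: N :: P :: G) x2 zero x0 == F' x2 zero x0) x0)) end.
    { apply EHA_nat_ind; [|apply EHA_allI, EHA_impI]; nrm; rewrite ?sub_F, ?sub_F'; nrm;
        [apply eq00 | apply eq0S]. }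
    revert A; nrm; now rewrite ?sub_F, ?sub_F'; nrm.
  - match goal with |- EHA ?K _ =>
      assert (A : EHA K (inst
        (@F (N :: N :: P :: N :: G) x2 (succ x3) x0 == F' x2 (succ x3) x0) x0)) end.
    { apply EHA_nat_ind; [|apply EHA_allI, EHA_impI]; nrm; rewrite ?sub_F, ?sub_F'; nrm;
        [apply eqS0 | apply eqSS].
      (* The outer induction hypothesis stands second, behind the inner one; it is taken at [next p]
         and the predecessor of the second index. *)
      match goal with |- eqt (_ :: ?A :: _) _ _ =>
        match A with fAll _ ?B =>
          pose proof (fun K J => EHA_allE x0
            (EHA_allE (H := K) (next x2) (EHA_hyp (A := fAll P B) J))) as E
        end end.
      revert E; nrm; rewrite ?sub_F, ?sub_F'; nrm; intro E; apply E; right; now left. }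
    revert A; nrm; now rewrite ?sub_F, ?sub_F'; nrm. }
pose proof (EHA_allE i (EHA_allE p A)) as E.
revert E; nrm; now rewrite !sub_F, !sub_F'; nrm.
Qed.
End DoubleRecursion.

(** * Identities for search, domains and initial segments *)

(** [succ], [fst_] and [snd_] are applications of constants, so this moves each of them out of a
    conditional. *)
Lemma if_app G (H : list (form G)) X Y b (f : tm G (X ~> Y)) t u :
  eqt H (if_ b (f @ t) (f @ u)) (f @ if_ b t u).
Proof.
assert (E : EHA H (inst (if_ x0 (ren_tm (fun _ => VS) f @ ren_tm (fun _ => VS) t)
    (ren_tm (fun _ => VS) f @ ren_tm (fun _ => VS) u)
  == ren_tm (fun _ => VS) f @ if_ x0 (ren_tm (fun _ => VS) t) (ren_tm (fun _ => VS) u)) b)).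
{ apply EHA_bool_ind; nrm; to_eqt; [now rewrite !if_true | now rewrite !if_false]. }
revert E; now nrm.
Qed.

Lemma ltN_succ_r G (H : list (form G)) n i :
  eqt H (ltN @ i @ succ n) (if_ (eqN @ n @ i) true_ (ltN @ i @ n)).
Proof.
apply (double_rec (F := fun _ (_ : tm _ N) n i => ltN @ i @ succ n)
  (F' := fun _ _ n i => if_ (eqN @ n @ i) true_ (ltN @ i @ n)) (next := fun _ p => p));
  [intros; now nrm ..| | | | | exact zero]; intros.
- now rewrite ltN0S, eqN00, if_true.
- now rewrite ltNSS, !ltN_0r, eqN0S, if_false.
- now rewrite !ltN0S, eqNS0, if_false.
- now rewrite !ltNSS, eqNSS.
Qed.

(** [initseg] builds from the front, while the thread adds its new value at the end. Lowering both
    indices replaces [a] by its tail, hence [next] is [tl]. *)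
Lemma update_initseg G (H : list (form G)) X (a : tm G (N ~> X)) n i :
  eqt H (if_ (eqN @ n @ i) (a @ n) (seqhat X @ (initseg X @ a @ n) @ i))
        (seqhat X @ (initseg X @ a @ succ n) @ i).
Proof.
apply (double_rec
  (F := fun _ (a : tm _ (N ~> X)) n i =>
     if_ (eqN @ n @ i) (a @ n) (seqhat X @ (initseg X @ a @ n) @ i))
  (F' := fun _ a n i => seqhat X @ (initseg X @ a @ succ n) @ i) (next := fun _ a => tl X @ a));
  [intros; now nrm ..| | | |]; clear; intros D H a.
- now rewrite eqN00, if_true, initsegS, seqhat_cons0.
- intro i; now rewrite eqN0S, if_false, initsegS, seqhat_consS, !initseg0, !seqhat_nil.
- intro n; now rewrite eqNS0, if_false, !initsegS, !seqhat_cons0.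
- intros n i IH. rewrite tlE in IH.
  now rewrite (initsegS _ a n), (initsegS _ a (succ n)), !seqhat_consS, eqNSS.
Qed.

(** The search returns the minimum of [k] and [n]. The conditional turns the claim that it is [n]
    unless [k < n] into an unconditional equation, as [double_rec] requires. *)
Lemma search_below G (H : list (form G)) k n :
  eqt H (if_ (ltN @ k @ n) n (search @ k @ (below @ n))) n.
Proof.
assert (tl_below : forall D (K : list (form D)) n, eqt K (tl B @ (below @ succ n)) (below @ n)).
{ intros; apply ext_eqt; intro K'; nrm. now rewrite tlE, !belowE, ltNSS. }
apply (double_rec
  (F := fun _ (_ : tm _ N) k n => if_ (ltN @ k @ n) n (search @ k @ (below @ n)))
  (F' := fun _ _ _ n => n) (next := fun _ p => p));
  [intros; now nrm ..| | | | | exact zero]; clear -tl_below; intros.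
- now rewrite ltN00, if_false, search0.
- now rewrite ltN0S, if_true.
- now rewrite ltNS0, if_false, searchS, belowE, ltN00, if_false.
- rewrite ltNSS, searchS, belowE, ltN0S, if_true, tl_below.
  etransitivity; [apply if_app|]. apply succ_eqt; assumption.
Qed.

Lemma update_below G (H : list (form G)) n :
  eqt H (update B @ (below @ n) @ n @ true_) (below @ succ n).
Proof. apply ext_eqt; intro K; nrm. now rewrite updateE, !belowE, ltN_succ_r. Qed.

Lemma update_seqhat G (H : list (form G)) X (a : tm G (N ~> X)) n :
  eqt H (update X @ (seqhat X @ (initseg X @ a @ n)) @ n @ (a @ n))
        (seqhat X @ (initseg X @ a @ succ n)).
Proof. apply ext_eqt; intro K; nrm. now rewrite updateE, update_initseg. Qed.

Lemma dom_cons G (H : list (form G)) Z (p : tm G (N ** Z)) u :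
  eqt H (dom Z @ cons_ p u) (update B @ (dom Z @ u) @ fst_ p @ true_).
Proof. apply ext_eqt; intro K; nrm. now rewrite updateE, dom_consE. Qed.

Lemma pw_fst_pfunhat_cons G (H : list (form G)) X Y (p : tm G (N ** (X ** Y))) u :
  eqt H (pw_fst X Y @ (pfunhat (X ** Y) @ cons_ p u))
        (update X @ (pw_fst X Y @ (pfunhat (X ** Y) @ u)) @ fst_ p @ fst_ (snd_ p)).
Proof.
apply ext_eqt; intro K; nrm. rewrite updateE, !pw_fstE, pfunhat_consE.
symmetry; apply if_app.
Qed.

Lemma pw_snd_pfunhat_cons G (H : list (form G)) X Y (p : tm G (N ** (X ** Y))) u :
  eqt H (pw_snd X Y @ (pfunhat (X ** Y) @ cons_ p u))
        (update Y @ (pw_snd X Y @ (pfunhat (X ** Y) @ u)) @ fst_ p @ snd_ (snd_ p)).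
Proof.
apply ext_eqt; intro K; nrm. rewrite updateE, !pw_sndE, pfunhat_consE.
symmetry; apply if_app.
Qed.

(** * The invariant of the thread *)

Definition query_thread G X (phi : tm G ((N ~> X) ~> N)) (a : tm G (N ~> X)) n :
  tm G (pfun (X ** B)) := thread (X ** B) @ (query X @ phi) @ (tag X @ a) @ n.

(** The domain decides whether [oplus] extends; the other two components are what [query] reads. The
    equations are between functions, so they can be rewritten inside the arguments of [search] and
    [phi]. *)
Definition represents_initseg G X (a : tm G (N ~> X)) n (u : tm G (pfun (X ** B))) : form G :=
  fAnd (dom (X ** B) @ u == below @ n)
    (fAnd (pw_snd X B @ (pfunhat (X ** B) @ u) == below @ n)
      (pw_fst X B @ (pfunhat (X ** B) @ u) == seqhat X @ (initseg X @ a @ n))).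

(** A Boolean term, so that [bool_cases] applies to it. *)
Definition stops G X (phi : tm G ((N ~> X) ~> N)) (a : tm G (N ~> X)) n : tm G B :=
  ltN @ (phi @ (seqhat X @ (initseg X @ a @ n))) @ n.

Definition spec_at G X (phi : tm G ((N ~> X) ~> N)) (a : tm G (N ~> X)) : form G :=
  fEx N (stops (ren_tm (fun _ => VS) phi) (ren_tm (fun _ => VS) a) x0 == true_).

Lemma spec_at_intro G (H : list (form G)) X (phi : tm G ((N ~> X) ~> N)) a n :
  eqt H (stops phi a n) true_ -> EHA H (spec_at phi a).
Proof. intro S; apply (EHA_exI (t := n)). unfold stops in *; nrm; exact S. Qed.

Section Invariant.
Context (G : ctx) (H : list (form G)) (X : ty).
Variables (phi : tm G ((N ~> X) ~> N)) (a : tm G (N ~> X)).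

Lemma query_represents n u :
  EHA H (represents_initseg a n u) -> eqt H (stops phi a n) false_ ->
  eqt H (query X @ phi @ (pfunhat (X ** B) @ u)) n.
Proof.
intros R S.
pose proof (EHA_andEl (EHA_andEr R) : eqt H _ _) as Esnd.
pose proof (EHA_andEr (EHA_andEr R) : eqt H _ _) as Efst.
unfold stops in S. rewrite queryE, Esnd, Efst.
(* The right-hand [n] is expanded to the conditional; by [S] its condition is false, which leaves
   the search. *)
rewrite <- (search_below H (phi @ (seqhat X @ (initseg X @ a @ n))) n) at 3.
now rewrite S, if_false.
Qed.

Lemma represents_initseg0 : EHA H (represents_initseg a zero (query_thread phi a zero)).
Proof.
unfold query_thread; repeat apply EHA_andI; to_eqt; rewrite thread0; apply ext_eqt; intro K; nrm.
- now rewrite dom_nil, belowE, ltN_0r.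
(* The default Boolean [false_] makes the second component agree with [below @ zero]. *)
- now rewrite pw_sndE, pfunhat_nil, canon_prod, snd_pair, canon_B, belowE, ltN_0r.
- now rewrite pw_fstE, pfunhat_nil, canon_prod, fst_pair, initseg0, seqhat_nil.
Qed.

Lemma represents_initsegS n :
  EHA H (represents_initseg a n (query_thread phi a n)) -> eqt H (stops phi a n) false_ ->
  EHA H (represents_initseg a (succ n) (query_thread phi a (succ n))).
Proof.
intros R S.
pose proof (EHA_andEl R : eqt H _ _) as Edom.
pose proof (EHA_andEl (EHA_andEr R) : eqt H _ _) as Esnd.
pose proof (EHA_andEr (EHA_andEr R) : eqt H _ _) as Efst.
(* The next query is [n], which lies outside the domain [below @ n], so [oplus] takes its extending
   branch. *)
assert (E : eqt H (query_thread phi a (succ n))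
                  (cons_ (pair_ n (pair_ (a @ n) true_)) (query_thread phi a n))).
{ unfold query_thread at 1. rewrite (threadS (query_represents R S)), tagE, oplusE.
  fold (query_thread phi a n). now rewrite fst_pair, Edom, belowE, ltN_irrefl, if_false. }
repeat apply EHA_andI; to_eqt; rewrite E.
- now rewrite dom_cons, fst_pair, Edom, update_below.
- now rewrite pw_snd_pfunhat_cons, !snd_pair, fst_pair, Esnd, update_below.
- now rewrite pw_fst_pfunhat_cons, !snd_pair, !fst_pair, Efst, update_seqhat.
Qed.
End Invariant.

Section SubstInvariant.
Context (G D : ctx) (s : sub G D) (X : ty).
Variables (phi : tm G ((N ~> X) ~> N)) (a : tm G (N ~> X)).
Lemma sub_query_thread n :
  sub_tm s (query_thread phi a n) = query_thread (sub_tm s phi) (sub_tm s a) (sub_tm s n).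
Proof. unfold query_thread; now nrm. Qed.
Lemma sub_represents_initseg n (u : tm G (pfun (X ** B))) :
  sub_form s (represents_initseg a n u)
  = represents_initseg (sub_tm s a) (sub_tm s n) (sub_tm s u).
Proof. unfold represents_initseg; now nrm. Qed.
Lemma sub_spec_at : sub_form s (spec_at phi a) = spec_at (sub_tm s phi) (sub_tm s a).
Proof. unfold spec_at, stops; now nrm. Qed.
End SubstInvariant.

(** Once [phi] has stopped, nothing is claimed about the thread; [spec_at] does not mention [n], so
    the left disjunct persists through the induction. *)
Lemma thread_invariant G (H : list (form G)) X (phi : tm G ((N ~> X) ~> N)) a n :
  EHA H (fOr (spec_at phi a) (represents_initseg a n (query_thread phi a n))).
Proof.
pose (phi' := ren_tm (fun _ => @VS G _ N) phi); pose (a' := ren_tm (fun _ => @VS G _ N) a).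
assert (E : EHA H (inst
  (fOr (spec_at phi' a') (represents_initseg a' x0 (query_thread phi' a' x0))) n));
  subst phi' a'.
{ apply EHA_nat_ind; [|apply EHA_allI, EHA_impI]; nrm;
    rewrite ?sub_spec_at, ?sub_represents_initseg, ?sub_query_thread; nrm.
  - apply EHA_orIr, represents_initseg0.
  - eapply EHA_orE; [apply EHA_hyp; now left | |].
    { apply EHA_orIl, EHA_hyp; now left. }
    (* If [phi] stops at the current length, that length witnesses [spec_at]; otherwise the thread
       grows by one entry. *)
    apply bool_cases with (b := stops (ren_tm (fun _ => VS) phi) (ren_tm (fun _ => VS) a) x0);
      intro S.
    + exact (EHA_orIl _ (spec_at_intro S)).
    + apply EHA_orIr, represents_initsegS; [apply EHA_hyp; right; now left | exact S]. }
revert E; nrm; now rewrite sub_spec_at, sub_represents_initseg, sub_query_thread; nrm.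
Qed.

(** * Derivation of Spec from sSpec *)

Theorem theorem2p9 (X : ty) : EHA [sSpec (X ** B)] (Spec X).
Proof.
apply EHA_allI, EHA_allI; unfold sSpec; nrm.
match goal with |- @EHA ?G [?S] _ =>
  assert (E : EHA [S] S) by (apply EHA_hyp; now left);
  change (EHA [S] (@spec_at G X x1 x0)) end.
(* sSpec is applied to [query X @ phi] and [tag X @ a]; the length it yields is the candidate for
   Spec. *)
apply (EHA_allE (query X @ x1)) in E.
apply (EHA_allE (A := sub_form _ _) (tag X @ x0)) in E.
revert E; nrm; intro E; refine (EHA_exE E _); clear E.
unfold wk; rewrite sub_spec_at; nrm.
eapply EHA_orE; [apply (thread_invariant _ x2 x1 x0) | apply EHA_hyp; now left |].
apply bool_cases with (b := stops x2 x1 x0); intro S.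
- exact (spec_at_intro S).
(* Without stopping, the query at this stage is [n] itself; sSpec puts it into the domain
   [below @ n], contradicting irreflexivity of [ltN]. *)
- match goal with |- EHA ?L _ =>
    assert (R : EHA L (represents_initseg x1 x0 (query_thread x2 x1 x0))) by
      (apply EHA_hyp; right; now left);
    assert (T : eqt L (dom (X ** B) @ query_thread x2 x1 x0 @
        (query X @ x2 @ (pfunhat (X ** B) @ query_thread x2 x1 x0))) true_) by
      (apply EHA_hyp; right; right; now left);
    revert R S T; generalize L; clear; intros K R S T end.
  refine (absurd_bool _ T _).
  rewrite (query_represents R S), (EHA_andEl R : eqt K _ _).
  now rewrite belowE, ltN_irrefl.
Qed.
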